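(* Let $\mathcal{R}(n)$ be the set of all reflexive binary relations on $[n]$. The weak order $(\mathcal{R}(n), \preccurlyeq)$ is a graded lattice whose meet and join are given by \[ R \wedge_{\mathcal{R}} S = (R^{\mathsf{Inc}} \cup S^{\mathsf{Inc}}) \cup (R^{\mathsf{Dec}} \cap S^{\mathsf{Dec}}) \qquad\text{and}\qquad R \vee_{\mathcal{R}} S = (R^{\mathsf{Inc}} \cap S^{\mathsf{Inc}}) \cup (R^{\mathsf{Dec}} \cup S^{\mathsf{Dec}}). \]
   Context: $[n] = \{1, \dots, n\}$. For a reflexive binary relation $R \subseteq [n]^2$, let $R^{\mathsf{Inc}} = \{(a,b) \in R : a \le b\}$ and $R^{\mathsf{Dec}} = \{(b,a) \in R : a \le b\}$. The weak order is defined by $R \preccurlyeq S$ if and only if $R^{\mathsf{Inc}} \supseteq S^{\mathsf{Inc}}$ and $R^{\mathsf{Dec}} \subseteq S^{\mathsf{Dec}}$. *)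

(* Defs.v *)
From HB Require Import structures.
From mathcomp Require Import all_boot.

Set Implicit Arguments.
Unset Strict Implicit.
Unset Printing Implicit Defensive.

Section Posets.
Variables (T : eqType) (le : rel T).

Definition is_porder : Prop := [/\ reflexive le, antisymmetric le & transitive le].

Definition is_meet (x y m : T) : Prop :=
  [/\ le m x, le m y & forall z, le z x -> le z y -> le z m].

Definition is_join (x y j : T) : Prop :=
  [/\ le x j, le y j & forall z, le x z -> le y z -> le j z].

Definition is_lattice : Prop :=
  is_porder /\
  forall x y, (exists m, is_meet x y m) /\ (exists j, is_join x y j).

Definition strict : rel T := fun x y => (x != y) && le x y.

Definition is_cover (x y : T) : Prop :=
  strict x y /\ forall z, ~ (strict x z /\ strict z y).

(* For a finite bounded poset this is equivalent to all maximal chains having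
   the same length. *)
Definition is_graded : Prop :=
  exists rk : T -> nat,
    (forall x y, strict x y -> rk x < rk y) /\
    (forall x y, is_cover x y -> rk y = (rk x).+1).

End Posets.

(* The ground set [n] = {1, ..., n} is represented by 'I_n = {0, ..., n - 1};
   only the linear order of its elements is used. *)
Record refl_rel (n : nat) : Type := ReflRel {
  graph :> {set 'I_n * 'I_n};
  _ : [forall a, (a, a) \in graph] }.

HB.instance Definition _ (n : nat) := [isSub for @graph n].
HB.instance Definition _ (n : nat) := [Finite of refl_rel n by <:].

Definition Inc (n : nat) (R : {set 'I_n * 'I_n}) : {set 'I_n * 'I_n} :=
  [set p in R | p.1 <= p.2].

Definition Dec (n : nat) (R : {set 'I_n * 'I_n}) : {set 'I_n * 'I_n} :=
  [set p in R | p.2 <= p.1].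

Definition weak_le (n : nat) : rel (refl_rel n) :=
  fun R S => (Inc S \subset Inc R) && (Dec R \subset Dec S).

(* Main.v *)
(** Send a reflexive relation [R] to its set of inversions: the pairs [(a, b)]
    with [a < b] absent from [R], together with the pairs [(a, b)] with [b <= a]
    present in [R]. This is an isomorphism from the weak order onto the Boolean
    lattice of the sets of pairs containing the diagonal. Meet and join become
    intersection and union, and the rank is the number of inversions. *)
Require Import Defs.
From HB Require Import structures.
From mathcomp Require Import all_boot.

(** Taking arbitrary sets, not only reflexive relations, makes this map its own inverse, so it also
    recovers a relation from its inversions. *)
Definition inversions {n : nat} (R : {set 'I_n * 'I_n}) : {set 'I_n * 'I_n} :=
  [set p : 'I_n * 'I_n | if p.1 < p.2 then p \notin R else p \in R].

Lemma inversionsK (n : nat) : involutive (@inversions n).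
Proof.
by move=> R; apply/setP=> p; rewrite !inE; case: ltnP => //; rewrite negbK.
Qed.

Lemma inversions_inj (n : nat) :
  injective (fun R : refl_rel n => inversions (graph R)).
Proof. by move=> R S /(can_inj (@inversionsK n)) /val_inj. Qed.

Lemma graph_refl (n : nat) (R : refl_rel n) (p : 'I_n * 'I_n) :
  p.1 = p.2 :> nat -> p \in graph R.
Proof.
by case: R p => A /= /forallP rA [a b] /= /val_inj ->.
Qed.

(** Complementing the pairs with [p.1 < p.2] reverses the inclusion of increasing parts, so both
    conditions of the weak order point the same way and merge into one. *)
Lemma weak_leE (n : nat) (R S : refl_rel n) :
  weak_le R S = (inversions R \subset inversions S).
Proof.
apply/andP/subsetP => [[/subsetP leI /subsetP leD] p | leRS].
  move: (leI p) (leD p); rewrite !inE; case: ltnP => [/ltnW ab|ba].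
    by rewrite ab !andbT => SR _; apply: contra.
  by rewrite !andbT.
split; apply/subsetP => p; move: (leRS p); rewrite !inE.
  case: ltngtP => [ab|ba|ab] //=; rewrite ?andbF ?andbT //.
    exact: contraTT.
  (* On the diagonal the hypothesis goes from [R] to [S] while [Inc] needs the converse; reflexivity
     supplies it. *)
  by rewrite !graph_refl.
by case: ltngtP => [ab|ba|ab] //=; rewrite ?andbF ?andbT.
Qed.

Lemma inversions_surj (n : nat) (A : {set 'I_n * 'I_n}) :
  (forall a, (a, a) \in A) -> exists R : refl_rel n, inversions R = A.
Proof.
move=> rA; have rI : [forall a, (a, a) \in inversions A].
  by apply/forallP => a; rewrite inE /= ltnn.
by exists (ReflRel rI); rewrite /= inversionsK.
Qed.

Lemma diag_inversions (n : nat) (R : refl_rel n) (a : 'I_n) :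
  (a, a) \in inversions R.
Proof. by rewrite inE /= ltnn graph_refl. Qed.

Lemma weak_le_porder (n : nat) : is_porder (@weak_le n).
Proof.
split=> [R|R S|S R T]; rewrite !weak_leE //; last exact: subset_trans.
by rewrite -eqEsubset => /eqP/inversions_inj.
Qed.

Lemma weak_meet (n : nat) (R S : refl_rel n) : exists2 M : refl_rel n,
  is_meet (@weak_le n) R S M &
  graph M = (Inc R :|: Inc S) :|: (Dec R :&: Dec S).
Proof.
have [a|M MI] := @inversions_surj n (inversions R :&: inversions S).
  by rewrite inE !diag_inversions.
exists M; first by split=> [||Z]; rewrite !weak_leE MI ?subsetIl ?subsetIr //
  subsetI => -> ->.
(* Mapping the intersection back, De Morgan turns it into a union on pairs with [p.1 < p.2] and
   leaves it unchanged on pairs with [p.2 < p.1]; diagonal pairs belong to both sides. *)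
rewrite -[LHS]inversionsK MI; apply/setP => p; rewrite !inE.
case: ltngtP => [ab|ba|ab] /=; rewrite ?andbT ?andbF ?orbF //.
  by rewrite negb_and !negbK.
by rewrite !graph_refl.
Qed.

Lemma weak_join (n : nat) (R S : refl_rel n) : exists2 J : refl_rel n,
  is_join (@weak_le n) R S J &
  graph J = (Inc R :&: Inc S) :|: (Dec R :|: Dec S).
Proof.
have [a|J JI] := @inversions_surj n (inversions R :|: inversions S).
  by rewrite inE !diag_inversions.
exists J; first by split=> [||Z]; rewrite !weak_leE JI ?subsetUl ?subsetUr //
  subUset => -> ->.
rewrite -[LHS]inversionsK JI; apply/setP => p; rewrite !inE.
case: ltngtP => [ab|ba|ab] /=; rewrite ?andbT ?andbF ?orbF //.
  by rewrite negb_or !negbK.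
by rewrite !graph_refl.
Qed.

Lemma strict_weakE (n : nat) (R S : refl_rel n) :
  strict (@weak_le n) R S = (inversions R \proper inversions S).
Proof.
by rewrite /strict weak_leE properEneq (inj_eq (@inversions_inj n)).
Qed.

Lemma weak_graded (n : nat) : is_graded (@weak_le n).
Proof.
exists (fun R => #|inversions (graph R)|); split=> R S.
  by rewrite strict_weakE => /proper_card.
rewrite /is_cover strict_weakE => -[ltRS noZ].
have /properP[sRS [p pS pR]] := ltRS.
(* Adding to [R] a single inversion of [S] gives [Z] strictly above [R] and below [S]. A cover
   leaves no room in between, so [Z] and [S] have the same inversions, one more than [R]. *)
have [a|Z ZI] := @inversions_surj n (p |: inversions R).
  by rewrite !inE /= ltnn graph_refl ?orbT.
have RZ : strict (@weak_le n) R Z by rewrite strict_weakE ZI properUr ?sub1set.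
have sZS : inversions Z \subset inversions S by rewrite ZI subUset sub1set pS.
suff <- : inversions Z = inversions S by rewrite ZI cardsU1 pR.
apply/eqP; rewrite -[_ == _]negbK; apply/negP => neZS.
by apply: (noZ Z); rewrite RZ strict_weakE properEneq neZS.
Qed.

Theorem proposition3 (n : nat) :
  [/\ is_lattice (@weak_le n),
      is_graded (@weak_le n),
      forall R S : refl_rel n, exists2 M : refl_rel n,
        is_meet (@weak_le n) R S M &
        graph M = (Inc R :|: Inc S) :|: (Dec R :&: Dec S)
    & forall R S : refl_rel n, exists2 J : refl_rel n,
        is_join (@weak_le n) R S J &
        graph J = (Inc R :&: Inc S) :|: (Dec R :|: Dec S)].
Proof.
split; [|exact: weak_graded|exact: weak_meet|exact: weak_join].
split=> [|R S]; first exact: weak_le_porder.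
by have [M RSM _] := weak_meet n R S; have [J RSJ _] := weak_join n R S;
   split; [exists M|exists J].
Qed.
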